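(* Let $d\in\mathbb{N}$. Every finite union $\bigcup_{i=1}^k\mathcal{P}_{\rho_i}$, where each $\rho_i$ is a $0$-profile (for some radius $r_i$ and degree $d$), is a GSF-local property of undirected graphs.
   Context: $\mathcal{C}_d$ is the class of finite simple undirected graphs of maximum degree at most $d$. For a graph $G$ and vertex $v$, $\mathcal{N}_r^G(v)$ is the subgraph induced by the vertices at distance at most $r$ from $v$. An $r$-ball is a pair $(B,b)$ with $b\in V(B)$ and every vertex of $B$ at distance at most $r$ from $b$; an $r$-type is an isomorphism class of $r$-balls (isomorphisms mapping centre to centre). There are finitely many $r$-types of graphs of degree at most $d$; fix an enumeration $\tau^1,\dots,\tau^{n_{d,r}}$. The $r$-histogram vector of $G\in\mathcal{C}_d$ has $i$-th entry the number of vertices $v$ with $(\mathcal{N}_r^G(v),v)\in\tau^i$. An $r$-neighbourhood profile of degree $d$ is a map $\rho$ from $\{1,\dots,n_{d,r}\}$ to the set of intervals $[k,l]$ ($k\le l\in\mathbb{N}$) and $[k,\infty)$ ($k\in\mathbb{N}$); $G$ obeys $\rho$ if its $i$-th histogram entry lies in $\rho(i)$ for all $i$, and $\mathcal{P}_\rho:=\{G\in\mathcal{C}_d\mid G\text{ obeys }\rho\}$. A $0$-profile is a profile all of whose values are of the form $[0,k]$ or $[0,\infty)$. For a vertex $v$, $N_1^G(v)$ is $v$ together with its neighbours. A marked graph is a graph each of whose vertices is marked 'full', 'semifull' or 'partial'. An embedding of a marked graph $F$ into $G$ is an injective $f:V(F)\to V(G)$ such that for every $v\in V(F)$: if $v$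 is full, $N_1^G(f(v))=f(N_1^F(v))$; if semifull, $N_1^G(f(v))\cap f(V(F))=f(N_1^F(v))$; if partial, $N_1^G(f(v))\supseteq f(N_1^F(v))$. $G$ is $\mathcal{F}$-free if no $F\in\mathcal{F}$ embeds into $G$. A property $\mathcal{P}=\bigcup_n\mathcal{P}_n$ ($\mathcal{P}_n$ the $n$-vertex members) is GSF-local if there are a sequence $(\mathcal{F}_n)_{n\in\mathbb{N}}$ of sets of marked graphs and an integer $s$ such that for every $n$ each graph in $\mathcal{F}_n$ has at most $s$ vertices and $\mathcal{P}_n$ is exactly the set of $n$-vertex graphs that are $\mathcal{F}_n$-free. *)

(* Defs.v *)
From mathcomp Require Import all_boot.

Set Implicit Arguments.
Unset Strict Implicit.
Unset Printing Implicit Defensive.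

Record sgraph := SGraph {
  svertex :> finType;
  sedge : rel svertex;
  sedge_sym : symmetric sedge;
  sedge_irr : irreflexive sedge
}.

Definition bounded_degree (d : nat) (G : sgraph) : bool :=
  [forall v : G, #|[set u : G | sedge v u]| <= d].

Definition closed_nbh (G : sgraph) (v : G) : {set G} :=
  [set u | (u == v) || sedge v u].

(* dist(u, v) <= r, i.e. there is a walk of length n <= r from u to v. *)
Definition within_dist (G : sgraph) (r : nat) (u v : G) : bool :=
  [exists n : 'I_r.+1, exists p : n.-tuple G,
     path (@sedge G) u p && (last u p == v)].

Section Induced.
Variables (G : sgraph) (A : {set G}).

Definition induced_edge : rel {x : G | x \in A} :=
  fun x y => sedge (val x) (val y).

Lemma induced_edge_sym : symmetric induced_edge.
Proof. by move=> x y; apply: sedge_sym. Qed.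

Lemma induced_edge_irr : irreflexive induced_edge.
Proof. by move=> x; apply: sedge_irr. Qed.

Definition induced : sgraph := SGraph induced_edge_sym induced_edge_irr.
End Induced.

Record rooted := Rooted {
  rgraph :> sgraph;
  root : rgraph
}.

Definition is_ball (r : nat) (B : rooted) : bool :=
  [forall v : B, within_dist r (root B) v].

Definition rooted_iso (B1 B2 : rooted) : bool :=
  [exists f : {ffun B1 -> B2},
    [&& injectiveb f, [forall y, y \in codom f], f (root B1) == root B2
      & [forall u, forall v, sedge (f u) (f v) == sedge u v]]].

Lemma within_dist_refl (G : sgraph) (r : nat) (v : G) : within_dist r v v.
Proof.
by apply/existsP; exists ord0; apply/existsP; exists [tuple]; rewrite /= eqxx.
Qed.

Definition ball_set (G : sgraph) (r : nat) (v : G) : {set G} :=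
  [set u | within_dist r v u].

Lemma center_in_ball (G : sgraph) (r : nat) (v : G) : v \in ball_set r v.
Proof. by rewrite inE within_dist_refl. Qed.

Definition nbhood (G : sgraph) (r : nat) (v : G) : rooted :=
  @Rooted (induced (ball_set r v)) (exist _ v (center_in_ball r v)).

(* An enumeration without repetition of the r-types of degree at most d, each
   isomorphism class being given by a representative.  The theorem is stated
   for an arbitrary such enumeration; rtype_enum_exists below shows that there
   always is one. *)
Record rtype_enum (d r : nat) := RTypeEnum {
  ntypes : nat;
  type_rep : 'I_ntypes -> rooted;
  type_rep_ball : forall i, is_ball r (type_rep i);
  type_rep_deg : forall i, bounded_degree d (type_rep i);
  type_rep_inj : forall i j, rooted_iso (type_rep i) (type_rep j) -> i = j;
  type_rep_surj : forall B : rooted, is_ball r B -> bounded_degree d B ->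
    exists i, rooted_iso B (type_rep i)
}.

Definition histogram (d r : nat) (tau : rtype_enum d r) (G : sgraph)
    (i : 'I_(ntypes tau)) : nat :=
  #|[set v : G | rooted_iso (nbhood r v) (type_rep i)]|.

Inductive interval :=
  | Bounded (k l : nat) of k <= l
  | Unbounded (k : nat).

Definition in_interval (m : nat) (I : interval) : bool :=
  match I with
  | Bounded k l _ => k <= m <= l
  | Unbounded k => k <= m
  end.

Definition lower_end (I : interval) : nat :=
  match I with Bounded k _ _ => k | Unbounded k => k end.

Definition profile (d r : nat) (tau : rtype_enum d r) : Type :=
  'I_(ntypes tau) -> interval.

Definition zero_profile (d r : nat) (tau : rtype_enum d r)
    (rho : profile tau) : Prop :=
  forall i, lower_end (rho i) = 0.

Definition obeys (d r : nat) (tau : rtype_enum d r) (rho : profile tau)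
    (G : sgraph) : Prop :=
  forall i, in_interval (histogram G i) (rho i).

Definition profile_property (d r : nat) (tau : rtype_enum d r)
    (rho : profile tau) (G : sgraph) : Prop :=
  bounded_degree d G /\ obeys rho G.

Inductive marking := Full | Semifull | Partial.

Record mgraph := MGraph {
  mbase :> sgraph;
  mark : mbase -> marking
}.

Definition embedding (F : mgraph) (G : sgraph) (f : F -> G) : Prop :=
  injective f /\
  forall v : F,
    match mark v with
    | Full => closed_nbh (f v) = f @: closed_nbh v
    | Semifull => closed_nbh (f v) :&: f @: [set: F] = f @: closed_nbh v
    | Partial => f @: closed_nbh v \subset closed_nbh (f v)
    end.

Definition free_of (Fs : mgraph -> Prop) (G : sgraph) : Prop :=
  forall F : mgraph, Fs F -> ~ exists f : F -> G, embedding f.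

Definition GSF_local (P : sgraph -> Prop) : Prop :=
  exists (Fs : nat -> mgraph -> Prop) (s : nat),
    forall n : nat,
      (forall F : mgraph, Fs n F -> #|F| <= s) /\
      (forall G : sgraph, #|G| = n -> (P G <-> free_of (Fs n) G)).

Section Existence.

Lemma rooted_isoP (B1 B2 : rooted) :
  reflect (exists f : B1 -> B2, [/\ bijective f, f (root B1) = root B2
             & forall u v, sedge (f u) (f v) = sedge u v])
          (rooted_iso B1 B2).
Proof.
apply: (iffP existsP) => [[f]|[f [fbij froot fE]]].
  case/and4P=> /injectiveP finj /forallP fsurj /eqP froot /forallP fE.
  exists f; split=> // [|u v]; last exact/eqP/(forallP (fE u)).
  by exists (fun y => iinv (fsurj y)) => [x|y]; rewrite ?f_iinv ?iinv_f.
exists (finfun f); apply/and4P; split.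
- by apply/injectiveP=> x y; rewrite !ffunE; apply: bij_inj.
- apply/forallP=> y; case: fbij => g fK gK; apply/codomP; exists (g y).
  by rewrite ffunE gK.
- by rewrite ffunE froot.
- by apply/forallP=> u; apply/forallP=> v; rewrite !ffunE fE.
Qed.

Lemma rooted_iso_sym (B1 B2 : rooted) : rooted_iso B1 B2 -> rooted_iso B2 B1.
Proof.
case/rooted_isoP=> f [[g fK gK] froot fE]; apply/rooted_isoP; exists g; split.
- by exists f.
- by rewrite -froot fK.
- by move=> u v; rewrite -fE !gK.
Qed.

Lemma rooted_iso_trans (B1 B2 B3 : rooted) :
  rooted_iso B1 B2 -> rooted_iso B2 B3 -> rooted_iso B1 B3.
Proof.
case/rooted_isoP=> f [fb froot fE]; case/rooted_isoP=> g [gb groot gE].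
apply/rooted_isoP; exists (g \o f); split; first exact: bij_comp.
  by rewrite /= froot.
by move=> u v; rewrite /= gE fE.
Qed.

Lemma within_distP (G : sgraph) r (u v : G) :
  reflect (exists p, [/\ path (@sedge G) u p, last u p = v & size p <= r])
          (within_dist r u v).
Proof.
apply: (iffP existsP) => [[n /existsP[p /andP[pp /eqP lp]]]|[p [pp lp sp]]].
  by exists p; split; rewrite // size_tuple -ltnS.
exists (Ordinal (sp : size p < r.+1)); apply/existsP; exists (in_tuple p).
by rewrite /= pp lp eqxx.
Qed.

Lemma within_dist_iso (B1 B2 : rooted) (f : B1 -> B2) r u v :
  (forall u v, sedge (f u) (f v) = sedge u v) ->
  within_dist r u v -> within_dist r (f u) (f v).
Proof.
move=> fE /within_distP[p [pp <- sp]]; apply/within_distP; exists (map f p).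
rewrite last_map size_map; split=> //.
by elim: p u pp {sp} => //= x p IHp u /andP[ux xp]; rewrite fE ux IHp.
Qed.

Lemma is_ball_iso (B1 B2 : rooted) r :
  rooted_iso B1 B2 -> is_ball r B1 -> is_ball r B2.
Proof.
case/rooted_isoP=> f [[g _ gK] froot fE] /forallP b1; apply/forallP=> v.
by rewrite -froot -(gK v); apply: within_dist_iso.
Qed.

Lemma bounded_degree_iso (B1 B2 : rooted) d :
  rooted_iso B1 B2 -> bounded_degree d B1 -> bounded_degree d B2.
Proof.
case/rooted_isoP=> f [[g fK gK] froot fE] /forallP b1; apply/forallP=> v.
apply: leq_trans (b1 (g v)).
rewrite -(card_imset _ (can_inj gK)); apply/subset_leq_card/subsetP => y.
by case/imsetP=> x; rewrite inE => vx ->; rewrite inE -fE !gK.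
Qed.

Lemma ball_set_card (G : sgraph) d r (v : G) :
  bounded_degree d G -> #|ball_set r v| <= d.+1 ^ r.
Proof.
move=> /forallP dG; elim: r => [|r IHr].
  rewrite expn0 -(cards1 v); apply/subset_leq_card/subsetP => u.
  rewrite !inE => /within_distP[p [_ <-]].
  by rewrite leqn0 size_eq0 => /eqP ->.
have nbh_card (w : G) : #|closed_nbh w| <= d.+1.
  have -> : closed_nbh w = w |: [set u | sedge w u] by apply/setP=> u; rewrite !inE.
  by rewrite cardsU1 inE sedge_irr add1n ltnS.
have sub : ball_set r.+1 v \subset \bigcup_(w in ball_set r v) closed_nbh w.
  apply/subsetP=> u; rewrite inE => /within_distP[p [pp <- sp]].
  case/lastP: p pp sp => [_ _|p x].
    by apply/bigcupP; exists v; rewrite ?center_in_ball // inE eqxx.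
  rewrite rcons_path size_rcons last_rcons ltnS => /andP[pp ex] sp.
  apply/bigcupP; exists (last v p); last by rewrite inE ex orbT.
  by rewrite inE; apply/within_distP; exists p.
apply: leq_trans (subset_leq_card sub) _.
apply: (@leq_trans (\sum_(w in ball_set r v) d.+1)).
  apply: (@leq_trans (\sum_(w in ball_set r v) #|closed_nbh w|)); last first.
    by apply: leq_sum => w _.
  elim/big_rec2: _ => [|w A m _ IH]; first by rewrite cards0.
  by apply: leq_trans (leq_card_setU _ _).1 _; rewrite leq_add2l.
by rewrite sum_nat_const expnSr leq_mul2r IHr orbT.
Qed.

Lemma ball_card d r (B : rooted) :
  is_ball r B -> bounded_degree d B -> #|B| <= d.+1 ^ r.
Proof.
move=> /forallP ball dB; apply: leq_trans (ball_set_card r (root B) dB).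
by apply/subset_leq_card/subsetP => u _; rewrite inE.
Qed.

Section Code.
Variables (m : nat) (E : {set 'I_m * 'I_m}).
Definition code_edge : rel 'I_m :=
  fun x y => (x != y) && (((x, y) \in E) || ((y, x) \in E)).
Lemma code_edge_sym : symmetric code_edge.
Proof. by move=> x y; rewrite /code_edge eq_sym orbC. Qed.
Lemma code_edge_irr : irreflexive code_edge.
Proof. by move=> x; rewrite /code_edge eqxx. Qed.
Definition code_graph : sgraph := SGraph code_edge_sym code_edge_irr.
End Code.

Definition codes (m : nat) : seq rooted :=
  [seq @Rooted (code_graph E) x | E <- enum {set 'I_m * 'I_m}, x <- enum 'I_m].

Lemma has_flatten (T : Type) (a : pred T) (ss : seq (seq T)) :
  has a (flatten ss) = has (has a) ss.
Proof. by elim: ss => //= s ss IHss; rewrite has_cat IHss. Qed.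

Lemma codes_complete (B : rooted) : has (rooted_iso B) (codes #|B|).
Proof.
pose E := [set p : 'I_#|B| * 'I_#|B| | sedge (enum_val p.1) (enum_val p.2)].
pose x := enum_rank (root B).
have iso : rooted_iso B (@Rooted (code_graph E) x).
  apply/rooted_isoP; exists enum_rank; split=> //.
    by exists enum_val => y; rewrite ?enum_rankK ?enum_valK.
  move=> u v; rewrite /= /code_edge !inE /= !enum_rankK.
  rewrite (inj_eq enum_rank_inj) [sedge v u]sedge_sym orbb.
  by case: eqP => //= ->; rewrite sedge_irr.
rewrite /codes has_flatten has_map; apply/hasP; exists E.
  by rewrite mem_enum.
by rewrite /= has_map; apply/hasP; exists x => //; rewrite mem_enum.
Qed.

Lemma dedup (s : seq rooted) :
  exists t : seq rooted, pairwise (fun x y => ~~ rooted_iso x y) t /\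
    (forall a : pred rooted, all a s -> all a t) /\
    (forall B, has (rooted_iso B) s -> has (rooted_iso B) t).
Proof.
elim: s => [|x s [t [pt [allt hast]]]]; first by exists [::].
case: (boolP (has (rooted_iso x) t)) => xt.
  exists t; split=> //; split=> [a /andP[_ /allt] //|B /= /orP[Bx|/hast //]].
  by apply: sub_has xt => y; apply: rooted_iso_trans.
exists (x :: t); split; first by rewrite /= pt andbT all_predC.
split=> [a /= /andP[-> /allt] //|B /= /orP[-> //|/hast ->]].
by rewrite orbT.
Qed.

Lemma rtype_enum_exists (d r : nat) : inhabited (rtype_enum d r).
Proof.
pose ok B := is_ball r B && bounded_degree d B.
pose s := filter ok (flatten (map codes (iota 0 (d.+1 ^ r).+1))).
have s_ok : all ok s by apply: filter_all.
have s_compl B : ok B -> has (rooted_iso B) s.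
  move=> okB; have /andP[bB dB] := okB.
  have : has (rooted_iso B) (flatten (map codes (iota 0 (d.+1 ^ r).+1))).
    rewrite has_flatten has_map; apply/hasP; exists #|B|.
      by rewrite mem_iota add0n ltnS; apply: ball_card.
    exact: codes_complete.
  rewrite /s; elim: (flatten _) => //= C u IHu /orP[BC|/IHu hu].
    by rewrite /ok (is_ball_iso BC) ?(bounded_degree_iso BC) //= BC.
  by case: (ok C); rewrite //= hu orbT.
have [t [pt [allt hast]]] := dedup s.
have t_ok := allt _ s_ok.
have t_compl B (okB : ok B) := hast _ (s_compl B okB).
case: t pt t_ok t_compl {allt hast} => [|x0 t'].
  move=> _ _ no; constructor.
  apply: (@RTypeEnum d r 0 (fun i => False_rect _ (notF (ltn_ord i)))).
  - by case.
  - by case.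
  - by case.
  - by move=> B b dB; move: (no B); rewrite /ok b dB => /(_ isT).
set t := x0 :: t' => pt /all_nthP t_ok t_compl; constructor.
have noniso (i j : 'I_(size t)) : i < j -> ~~ rooted_iso (nth x0 t i) (nth x0 t j).
  by move=> ij; apply: (pairwiseP x0 pt) => //; apply: ltn_ord.
apply: (@RTypeEnum d r (size t) (fun i => nth x0 t i)).
- by move=> i; case/andP: (t_ok x0 i (ltn_ord i)).
- by move=> i; case/andP: (t_ok x0 i (ltn_ord i)).
- move=> i j ij; apply: val_inj; case: (ltngtP i j) => // lt.
    by move: (noniso _ _ lt); rewrite ij.
  by move: (noniso _ _ lt); rewrite (rooted_iso_sym ij).
- move=> B b dB; have: has (rooted_iso B) t by apply: t_compl; rewrite /ok b.
  by case/(has_nthP x0) => i it iso; exists (Ordinal it).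
Qed.

End Existence.

(* Main.v *)
Require Import Defs.
From mathcomp Require Import all_boot.

(** A 0-profile is violated by a graph [G] of degree at most [d] exactly when
some type occurs more often than allowed, and finitely many centres of that type
already witness this.  Take the subgraph induced on the union [A] of the balls
around such centres, one violated bound for each profile of the union, and mark
a vertex full when its whole neighbourhood lies in [A] and semifull otherwise.
An embedding of this marked graph into a graph [H] carries these balls onto
balls of [H], so [H] violates all the profiles too; and its size is bounded
independently of [G].  Hence one may forbid all marked graphs of bounded size
that embed into no member of the property. *)

Set Implicit Arguments.
Unset Strict Implicit.
Unset Printing Implicit Defensive.

Lemma within_distSP (G : sgraph) r (v w : G) :
  reflect (exists2 x, within_dist r v x & w \in closed_nbh x)
          (within_dist r.+1 v w).
Proof.
apply: (iffP (within_distP _ _ _)) => [[p [pp <- sp]]|[x]].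
  case/lastP: p pp sp => [_ _|p x].
    by exists v; rewrite ?within_dist_refl // inE eqxx.
  rewrite rcons_path size_rcons last_rcons ltnS => /andP[pp ex] sp.
  exists (last v p); last by rewrite inE ex orbT.
  by apply/within_distP; exists p.
case/within_distP=> p [pp lp sp]; rewrite inE => /orP[/eqP ->|xw].
  by exists p; split=> //; apply: leqW.
exists (rcons p w); split; last by rewrite size_rcons.
  by rewrite rcons_path pp lp.
by rewrite last_rcons.
Qed.

Lemma within_dist0 (G : sgraph) (v w : G) : within_dist 0 v w = (w == v).
Proof.
apply/idP/eqP => [/within_distP[p [_ <-]]|->]; last exact: within_dist_refl.
by rewrite leqn0 size_eq0 => /eqP ->.
Qed.

Lemma bigcup_card_leq (I T : finType) (A : {set I}) (B : I -> {set T}) :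
  #|\bigcup_(i in A) B i| <= \sum_(i in A) #|B i|.
Proof.
elim/big_rec2: _ => [|i m S _ IH]; first by rewrite cards0.
by apply: leq_trans (leq_card_setU _ _).1 _; rewrite leq_add2l.
Qed.

Lemma subset_of_card (T : finType) (A : {set T}) n :
  n <= #|A| -> exists2 S : {set T}, S \subset A & #|S| = n.
Proof.
move=> nA; exists [set x in take n (enum A)].
  by apply/subsetP=> x; rewrite inE => /mem_take; rewrite mem_enum.
rewrite cardsE (card_uniqP _) ?take_uniq ?enum_uniq //.
by rewrite size_takel // -cardE.
Qed.

Definition partialb (m : marking) : bool :=
  if m is Partial then true else false.

Definition fullb (m : marking) : bool := if m is Full then true else false.

Section EmbeddingBalls.
Variables (F : mgraph) (H : sgraph) (f : F -> H).
Hypotheses (f_emb : embedding f) (no_partial : forall v : F, ~~ partialb (mark v)).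

(** A full or semifull mark at [u] determines which vertices of the image lie in the closed
    neighbourhood of [f u], so non-edges are preserved too. *)
Lemma embedding_edge u v : sedge (f u) (f v) = sedge u v.
Proof.
have [f_inj f_mark] := f_emb.
have nbhE : (f v \in closed_nbh (f u)) = (v \in closed_nbh u).
  move: (f_mark u) (no_partial u).
  rewrite -(mem_imset (closed_nbh u) v f_inj).
  by case: (mark u) => // <- // _; rewrite in_setI imset_f ?inE // andbT.
move: nbhE; rewrite !inE (inj_eq f_inj).
by case: eqP => //= ->; rewrite !sedge_irr.
Qed.

Lemma embedding_within_dist r u v :
  within_dist r u v -> within_dist r (f u) (f v).
Proof.
exact: (@within_dist_iso (Rooted u) (Rooted (f u)) f r u v embedding_edge).
Qed.

Variables (r : nat) (v : F).
Hypothesis full_inside : forall n u, n < r -> within_dist n v u -> fullb (mark u).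

(** A walk of length at most [r] from [f v] cannot leave the image: each vertex before its last is
    the image of a full vertex. *)
Lemma embedding_ball : ball_set r (f v) = f @: ball_set r v.
Proof.
have [f_inj f_mark] := f_emb.
apply/setP=> w; rewrite inE; apply/idP/imsetP => [|[u]]; last first.
  by rewrite inE => vu ->; apply: embedding_within_dist.
suff step n : n <= r -> within_dist n (f v) w ->
    exists2 u, within_dist n v u & w = f u.
  by case/step=> // u vu ->; exists u; rewrite ?inE.
elim: n w => [|n IHn] w nr.
  by rewrite within_dist0 => /eqP ->; exists v; rewrite ?within_dist_refl.
case/within_distSP=> x /(IHn _ (ltnW nr))[y vy ->].
move: (f_mark y) (full_inside nr vy).
case: (mark y) => // -> _ /imsetP[u uy ->]; exists u => //.
by apply/within_distSP; exists y.
Qed.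

Lemma embedding_nbhood : rooted_iso (nbhood r v) (nbhood r (f v)).
Proof.
have [f_inj _] := f_emb.
have inB (x : nbhood r v) : f (val x) \in ball_set r (f v).
  by rewrite embedding_ball imset_f //; apply: valP x.
pose g (x : nbhood r v) : nbhood r (f v) := exist _ (f (val x)) (inB x).
apply/rooted_isoP; exists g; split.
- apply: inj_card_bij => [x y /(congr1 val)/= /f_inj/val_inj //|].
  by rewrite !card_sig embedding_ball card_imset.
- exact: val_inj.
- by move=> x y; apply: embedding_edge.
Qed.

End EmbeddingBalls.

Section MarkedInduced.
Variables (G : sgraph) (A : {set G}).

Definition marked_induced : mgraph :=
  @MGraph (induced A)
    (fun x => if closed_nbh (val x) \subset A then Full else Semifull).

Lemma marked_induced_no_partial (x : marked_induced) : ~~ partialb (mark x).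
Proof. by rewrite /=; case: ifP. Qed.

Lemma card_marked_induced : #|marked_induced| = #|A|.
Proof. exact: card_sig. Qed.

(** Keeps counted vertices distinct, so that lower bounds on counts pass to [H]. *)
Lemma card_marked_induced_imset (H : finType) (f : marked_induced -> H)
    (S : {set G}) :
  injective f -> S \subset A -> #|f @: [set x | val x \in S]| = #|S|.
Proof.
move=> f_inj /subsetP SA; rewrite card_imset // -(card_imset _ val_inj).
apply: eq_card => x; apply/imsetP/idP => [[y]|xS]; first by rewrite inE => yS ->.
by exists (exist _ x (SA x xS)); rewrite ?inE.
Qed.

Lemma imset_closed_nbh (x : marked_induced) :
  (val : marked_induced -> G) @: closed_nbh x = closed_nbh (val x) :&: A.
Proof.
apply/setP=> y; rewrite inE; apply/imsetP/andP => [[z zx ->]|[yx yA]].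
  by split; [move: zx; rewrite !inE | apply: valP z].
by exists (exist _ y yA) => //; move: yx; rewrite !inE.
Qed.

Lemma marked_induced_embedding : embedding (val : marked_induced -> G).
Proof.
split=> [|x]; first exact: val_inj.
have imT : (val : marked_induced -> G) @: [set: marked_induced] = A.
  apply/setP=> y; apply/imsetP/idP => [[z _ ->]|yA]; first exact: valP z.
  by exists (exist _ y yA).
rewrite /= imset_closed_nbh; case: ifP => [/setIidPl -> //|_].
by rewrite imT.
Qed.

(** [val] and [f] embed the same marked graph, so both balls are copies of the ball around [v]
    inside it. *)
Lemma marked_induced_nbhood r (H : sgraph) (f : marked_induced -> H)
    (v : marked_induced) :
  embedding f -> ball_set r (val v) \subset A ->
  rooted_iso (nbhood r (f v)) (nbhood r (val v)).
Proof.
move=> f_emb vA.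
(* The closed neighbourhood of a vertex at distance below [r] stays in the [r]-ball, hence in
   [A]. *)
have full n u : n < r -> within_dist n v u -> fullb (mark u).
  move=> nr vu; rewrite /= (_ : closed_nbh (val u) \subset A) //.
  apply/subsetP=> w wu; apply: (subsetP vA); rewrite inE.
  have: within_dist n.+1 (val v) w.
    apply/within_distSP; exists (val u) => //.
    exact: (embedding_within_dist marked_induced_embedding
              marked_induced_no_partial vu).
  case/within_distP=> p [pp lp sp]; apply/within_distP; exists p.
  by split=> //; apply: leq_trans sp nr.
have no_part := marked_induced_no_partial.
apply: rooted_iso_trans
  (embedding_nbhood marked_induced_embedding no_part full).
by apply/rooted_iso_sym/(embedding_nbhood f_emb no_part full).
Qed.

End MarkedInduced.

(* The least number of occurrences violating [I] when [I] is [[0, l]];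
   [0] is a junk value for unbounded intervals. *)
Definition excess (I : interval) : nat :=
  if I is Bounded _ l _ then l.+1 else 0.

Lemma excess_leq (I : interval) m :
  lower_end I = 0 -> ~~ in_interval m I -> excess I <= m.
Proof. by case: I => [k l kl|k] /= ->; rewrite // leq0n /= -ltnNge. Qed.

(** With lower end 0 an interval is violated only from above, so violation persists for larger
    counts. *)
Lemma excess_violates (I : interval) m m' :
  lower_end I = 0 -> ~~ in_interval m I -> excess I <= m' ->
  ~~ in_interval m' I.
Proof. by case: I => [k l kl|k] /= ->; rewrite //= -!ltnNge. Qed.

(** A vertex with [d.+1] of its neighbours suffices, since embeddings are injective and preserve
    edges. *)
Lemma degree_witness d (G : sgraph) :
  ~~ bounded_degree d G ->
  exists A : {set G}, #|A| <= d.+2 /\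
    forall (H : sgraph) (f : marked_induced A -> H),
      embedding f -> ~~ bounded_degree d H.
Proof.
case/forallPn=> v; rewrite -ltnNge => /subset_of_card[S /subsetP Sv cS].
exists (v |: S); split=> [|H f f_emb].
  by rewrite cardsU1 cS -[d.+2]add1n leq_add2r leq_b1.
pose c : marked_induced (v |: S) := exist _ v (setU11 v S).
apply/forallPn; exists (f c); rewrite -ltnNge -cS.
rewrite -(card_marked_induced_imset f_emb.1 (subsetUr [set v] S)).
apply/subset_leq_card/subsetP=> _ /imsetP[x xS ->]; rewrite !inE in xS *.
rewrite (embedding_edge f_emb (@marked_induced_no_partial _ _)).
by have := Sv _ xS; rewrite inE.
Qed.

Theorem theorem7p11 (d : nat) (tau : forall r : nat, rtype_enum d r)
    (k : nat) (r : 'I_k -> nat) (rho : forall i : 'I_k, profile (tau (r i))) :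
  (forall i : 'I_k, zero_profile (rho i)) ->
  GSF_local (fun G : sgraph => exists i : 'I_k, profile_property (rho i) G).
Proof.
move=> rho0.
pose P G := exists i : 'I_k, profile_property (rho i) G.
(* [d.+2] serves the degree obstruction; the sum bounds the union of balls, over all [j] because the
   violated type depends on [G]. *)
pose s := d.+2 + \sum_i \sum_j excess (rho i j) * d.+1 ^ r i.
exists (fun _ (F : mgraph) => #|F| <= s /\
          forall H, P H -> ~ exists f : F -> H, embedding f), s.
move=> n; split=> [F [] //|G _]; split=> [PG F [_ /(_ G PG)] //|G_free].
(* A small induced marked subgraph embeds into [G], so by freeness it must also embed into some
   member of [P]. *)
have block (A : {set G}) : #|A| <= s ->
    (forall (H : sgraph) (f : marked_induced A -> H), embedding f -> ~ P H) -> False.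
  move=> As noP; apply: (G_free (marked_induced A)); last first.
    by exists val; apply: marked_induced_embedding.
  by rewrite card_marked_induced; split=> // H PH [f /noP].
have [dG|/degree_witness[A [Ad noH]]] := boolP (bounded_degree d G); last first.
  case: (block A) => [|H f /noH /negP dH [i [] //]].
  exact: leq_trans Ad (leq_addr _ _).
have [/existsP[i /forallP obG]|/existsPn viol] :=
  boolP [exists i, forall j, in_interval (histogram G j) (rho i j)].
  by exists i.
(* Exactly [excess] many centres keep the union of balls small, yet any count at least as large
   still violates the bound. *)
have /fin_all_exists[S S_viol] i : exists S : {set G}, exists j,
    [/\ #|S| = excess (rho i j),
        S \subset [set v | rooted_iso (nbhood (r i) v) (type_rep j)]
      & forall m, #|S| <= m -> ~~ in_interval m (rho i j)].
  have /forallPn[j nj] := viol i.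
  have [S SA cS] := subset_of_card (excess_leq (rho0 i j) nj).
  exists S, j; split=> // m; rewrite cS.
  exact: (excess_violates (rho0 i j) nj).
pose A := \bigcup_(i in [set: 'I_k]) \bigcup_(v in S i) ball_set (r i) v.
case: (block A) => [|H f f_emb [i [dH obH]]].
  apply: leq_trans (leq_addl _ _); apply: leq_trans (bigcup_card_leq _ _) _.
  rewrite big_mkcond; apply: leq_sum => i _; rewrite inE.
  have [j [cS _ _]] := S_viol i; apply: leq_trans (bigcup_card_leq _ _) _.
  rewrite (bigD1 j) //= -cS; apply: leq_trans (leq_addr _ _).
  rewrite -sum_nat_const; apply: leq_sum => v _; exact: ball_set_card.
(* The centres in [S i] go to equally many vertices of type [j] in [H], which breaks [rho i] there
   too. *)
have [j [_ /subsetP Sj /(_ _ _)/negP]] := S_viol i; apply; last exact: obH j.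
have ballA v : v \in S i -> ball_set (r i) v \subset A.
  move=> vS; apply: subset_trans (bigcup_sup i _); last by rewrite inE.
  exact: bigcup_sup vS.
have SA : S i \subset A.
  by apply/subsetP=> v /ballA/subsetP; apply; apply: center_in_ball.
rewrite -(card_marked_induced_imset f_emb.1 SA).
apply/subset_leq_card/subsetP=> _ /imsetP[x xS ->]; rewrite inE in xS.
rewrite inE; apply: rooted_iso_trans (_ : rooted_iso (nbhood _ (val x)) _).
  exact: marked_induced_nbhood (ballA _ xS).
by have := Sj _ xS; rewrite inE.
Qed.
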